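(* Let $\sigma>0$, let $F:\mathcal{P}(\mathbb{R}^d)\to\mathbb{R}$ admit first and second order flat derivatives $\frac{\delta F}{\delta m}$ and $\frac{\delta^2 F}{\delta m^2}$, and suppose: (i) $F$ is convex, i.e. $F(m)-F(m')\le\int_{\mathbb{R}^d}\frac{\delta F}{\delta m}(m,x)(m-m')(dx)$ for all $m,m'\in\mathcal{P}(\mathbb{R}^d)$; (ii) there is $C>0$ with $\left|\frac{\delta F}{\delta m}(m,x)\right|\le C$ for all $m\in\mathcal{P}(\mathbb{R}^d)$, $x\in\mathbb{R}^d$; (iii) there is $C_2>0$ with $\left|\frac{\delta^2 F}{\delta m^2}(m,x,y)\right|\le C_2$ for all $m\in\mathcal{P}(\mathbb{R}^d)$, $x,y\in\mathbb{R}^d$. Let $\pi(dx)\propto\exp\left(-\frac{2}{\sigma^2}U(x)\right)dx$ be an absolutely continuous probability measure with potential $U:\mathbb{R}^d\to\mathbb{R}$, and let $m_0\in\mathcal{P}(\mathbb{R}^d)$ be absolutely continuous and such that, for some constants $r>0$ and $R>1$, $$\inf_{x\in\mathbb{R}^d}\frac{m_0(x)}{\pi(x)}\ge r,\qquad \sup_{x\in\mathbb{R}^d}\frac{m_0(x)}{\pi(x)}\le R.$$ Put $V^\sigma(m)=F(m)+\frac{\sigma^2}{2}\operatorname{KL}(m|\pi)$ and $a(m,x)=\frac{\delta F}{\delta m}(m,x)+\frac{\sigma^2}{2}\log\left(\frac{m(x)}{\pi(x)}\right)-\frac{\sigma^2}{2}\operatorname{KL}(m|\pi)$. Let $m^{\sigma,*}$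 be the minimizer of $V^\sigma$, and let $(m_t)_{t\ge0}$ be the solution of $\partial_tm_t(x)=-a(m_t,x)m_t(x)$ with initial condition $m_0$. Let $\bar r_1>0$ and $\bar R_1>1$ be constants such that $$\bar r_1\le\frac{m_t(x)}{m^{\sigma,*}(x)}\le\bar R_1\qquad\text{for all }t\ge0\text{ and all }x\in\mathbb{R}^d$$ (such constants exist when $F$ is convex with $\left|\frac{\delta F}{\delta m}\right|\le C$ and $\left|\frac{\delta^2 F}{\delta m^2}\right|\le C_2$ everywhere, and $r\le\frac{m_0(x)}{\pi(x)}\le R$ for all $x\in\mathbb{R}^d$). Then $$V^\sigma(m_t)-V^\sigma(m^{\sigma,*})\le\frac{4\bar R_1}{\sigma^2\bar r_1}\left\|a(m_t,\cdot)\right\|_{L^2(m_t)}^2\qquad\text{for all }t\ge0.$$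
   Context: $\mathcal{P}(\mathbb{R}^d)$ is the space of Borel probability measures on $\mathbb{R}^d$; an absolutely continuous (with respect to Lebesgue measure) probability measure $m$ is identified with its density $x\mapsto m(x)$. KL-divergence: $\operatorname{KL}(m|\pi)=\int_{\mathbb{R}^d}\log\left(\frac{m(x)}{\pi(x)}\right)m(x)\,dx$ if $m$ is absolutely continuous with respect to $\pi$, and $+\infty$ otherwise. Flat derivative: $G:\mathcal{P}(\mathbb{R}^d)\to\mathbb{R}$ admits a (first order) flat derivative if there is a functional $\frac{\delta G}{\delta m}:\mathcal{P}(\mathbb{R}^d)\times\mathbb{R}^d\to\mathbb{R}$ such that (1) for every $a\in\mathbb{R}^d$, $m\mapsto\frac{\delta G}{\delta m}(m,a)$ is continuous (for the weak topology); (2) for every $m$, $a\mapsto\frac{\delta G}{\delta m}(m,a)$ is bounded; (3) for all $m,m'\in\mathcal{P}(\mathbb{R}^d)$, $G(m')-G(m)=\int_0^1\int_{\mathbb{R}^d}\frac{\delta G}{\delta m}(m+\lambda(m'-m),a)(m'-m)(da)\,d\lambda$. It is defined only up to an additive constant (in $a$), and is always normalized by $\int_{\mathbb{R}^d}\frac{\delta G}{\delta m}(m,x)\,m(dx)=0$. $F$ admits a second order flat derivative $\frac{\delta^2F}{\delta m^2}:\mathcal{P}(\mathbb{R}^d)\times\mathbb{R}^d\times\mathbb{R}^d\to\mathbb{R}$ if for each $a\in\mathbb{R}^d$ the functional $m\mapsto\frac{\delta F}{\delta m}(m,a)$ admits a flat derivative $\frac{\delta^2F}{\delta m^2}(m,\cdot,a)$;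 so $\frac{\delta F}{\delta m}(m',a)-\frac{\delta F}{\delta m}(m,a)=\int_0^1\int_{\mathbb{R}^d}\frac{\delta^2F}{\delta m^2}(m+\lambda(m'-m),a',a)(m'-m)(da')\,d\lambda$. It is known that $V^\sigma$ is minimized by an absolutely continuous measure $m^{\sigma,*}\in\mathcal{P}(\mathbb{R}^d)$ satisfying $m^{\sigma,*}(x)=\frac1Z\exp\left(-\frac{2}{\sigma^2}\left(\frac{\delta F}{\delta m}(m^{\sigma,*},x)+U(x)\right)\right)$ with $Z$ the normalizing constant. A solution $(m_t)_{t\ge0}$ is a family of absolutely continuous probability measures, equal to $m_0$ at $t=0$, whose densities satisfy the equation for $t\ge0$ and $x\in\mathbb{R}^d$ (in particular $\operatorname{KL}(m_t|\pi)<\infty$). Under the stated hypotheses the paper establishes that such a solution exists and is unique. $\|g\|_{L^2(m)}^2=\int_{\mathbb{R}^d}|g(x)|^2m(x)\,dx$. *)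

(* Defs.v *)
Set Warnings "-notation-overridden,-ambiguous-paths,-notation-incompatible-prefix,-redundant-canonical-projection".
From HB Require Import structures.
From mathcomp Require Import all_boot all_order all_algebra.
From mathcomp Require Import all_classical all_reals all_analysis.
Import Order.TTheory GRing.Theory Num.Theory.
Import numFieldNormedType.Exports.

Set Implicit Arguments.
Unset Strict Implicit.
Unset Printing Implicit Defensive.

Local Open Scope classical_set_scope.
Local Open Scope ring_scope.
Local Open Scope charge_scope.

(* R^d is the type of d-tuples with the library's product sigma-algebra, which
   is the Borel sigma-algebra of R^d. *)
Notation Rd R d := (d.-tuple (measurableTypeR R)).

(* The Lebesgue measure of R^d, missing from the library, is built by iterated
   products, starting from the Dirac measure on the one-point space R^0. *)
Section sigma_finite_prod.
Context d1 d2 (T1 : measurableType d1) (T2 : measurableType d2) (R : realType).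

Lemma sigma_finite_prod (m1 : {sigma_finite_measure set T1 -> \bar R})
  (m2 : {sigma_finite_measure set T2 -> \bar R}) :
  sigma_finite setT (m1 \x m2)%E.
Proof.
have /sigma_finiteP[F [TF ndF Foo]] := sigma_finiteT m1.
have /sigma_finiteP[G [TG ndG Goo]] := sigma_finiteT m2.
exists (fun n => F n `*` G n).
  rewrite -setXTT TF TG predeqE => -[x y]; split.
    move=> [/= [n _ Fnx] [k _ Gky]]; exists (maxn n k) => //; split.
    - by move: x Fnx; exact/subsetPset/ndF/leq_maxl.
    - by move: y Gky; exact/subsetPset/ndG/leq_maxr.
  by move=> [n _ []/= ? ?]; split; exists n.
move=> k; have [? ?] := Foo k; have [? ?] := Goo k.
split; first exact: measurableX.
by rewrite product_measure1E// lte_mul_pinfty// ge0_fin_numE.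
Qed.

End sigma_finite_prod.

Section cons_measure.
Context (R : realType) (d : nat)
  (mu : {sigma_finite_measure set (Rd R d) -> \bar R}).

Definition tuple_cons (z : measurableTypeR R * Rd R d) : Rd R d.+1 :=
  [tuple of z.1 :: z.2].

Lemma measurable_tuple_cons : measurable_fun setT tuple_cons.
Proof.
exact: (@measurable_cons _ _ _ _ fst d snd measurable_fst measurable_snd).
Qed.

Definition cons_measure (A : set (Rd R d.+1)) : \bar R :=
  pushforward (lebesgue_measure \x mu)%E tuple_cons A.

Let cons_measure0 : cons_measure set0 = 0%E.
Proof. by rewrite /cons_measure /pushforward preimage_set0 measure0. Qed.

Let cons_measure_ge0 A : (0 <= cons_measure A)%E.
Proof. by rewrite /cons_measure /pushforward; exact: measure_ge0. Qed.

Let cons_measure_sigma_additive : semi_sigma_additive cons_measure.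
Proof.
move=> F mF tF mUF; rewrite /cons_measure /pushforward preimage_bigcup.
apply: measure_semi_sigma_additive.
- by move=> n; rewrite -[X in measurable X]setTI; exact: measurable_tuple_cons.
- apply/trivIsetP => /= i j _ _ ij; rewrite -preimage_setI.
  by move/trivIsetP : tF => /(_ _ _ _ _ ij) ->//; rewrite preimage_set0.
- rewrite -preimage_bigcup -[X in measurable X]setTI.
  exact: measurable_tuple_cons.
Qed.

HB.instance Definition _ := isMeasure.Build _ _ _
  cons_measure cons_measure0 cons_measure_ge0 cons_measure_sigma_additive.

Let tuple_uncons (t : Rd R d.+1) : measurableTypeR R * Rd R d :=
  (thead t, [tuple of behead t]).

Let tuple_consK (z : measurableTypeR R * Rd R d) : tuple_uncons (tuple_cons z) = z.
Proof.
case: z => x t; rewrite /tuple_uncons /tuple_cons /=; congr pair.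
exact: val_inj.
Qed.

Let measurable_tuple_uncons : measurable_fun setT tuple_uncons.
Proof.
apply/measurable_fun_pair => /=.
  exact: measurable_tnth.
exact: measurable_behead.
Qed.

Let cons_measure_sigma_finite : sigma_finite setT cons_measure.
Proof.
have [F UF mF] := sigma_finite_prod lebesgue_measure mu.
exists (fun n => tuple_uncons @^-1` F n).
  by rewrite -preimage_bigcup -UF preimage_setT.
move=> n; have [mFn Fnoo] := mF n; split.
  by rewrite -[X in measurable X]setTI; exact: measurable_tuple_uncons.
rewrite /cons_measure /pushforward.
rewrite (_ : _ @^-1` _ = F n) //.
by apply/seteqP; split => z /=; rewrite tuple_consK.
Qed.

HB.instance Definition _ := Measure_isSigmaFinite.Build _ _ _
  cons_measure cons_measure_sigma_finite.

End cons_measure.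

Fixpoint lebesgue (R : realType) (d : nat) :
    {sigma_finite_measure set (Rd R d) -> \bar R} :=
  match d with
  | 0 => \d_([tuple] : Rd R 0)
  | d'.+1 => cons_measure (lebesgue R d')
  end.

Section weak_topology.
Context (R : realType) (d : nat).

Definition tuple_of_row (v : 'rV[R]_d) : Rd R d := [tuple v ord0 i | i < d].

(* Continuity on R^d is continuity for the topology of 'rV[R]_d, since tuples
   carry no topology in the library. *)
Record bcfun := BCFun {
  bcfun_fun :> Rd R d -> R;
  bcfun_continuous : continuous (bcfun_fun \o tuple_of_row);
  bcfun_bounded : exists K : R, forall x, `|bcfun_fun x| <= K }.

HB.instance Definition _ := gen_eqMixin bcfun.
HB.instance Definition _ := gen_choiceMixin bcfun.

Definition pairing (m : probability (Rd R d) R) : {ptws bcfun -> R} :=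
  fun f => \int[m]_x f x.

(* The coarsest topology making every m |-> \int f dm continuous. *)
Definition weak_prob : Type := initial_topology pairing.
HB.instance Definition _ := Topological.on weak_prob.

End weak_topology.

Section mixture.
Context (R : realType) (d : nat).
Local Notation P := (probability (Rd R d) R).

(* m + l (m' - m) for l in [0, 1]; other values of l are clamped to [0, 1],
   which makes the mixture a probability measure for every real l. *)
Definition clamp (l : R) : R := Num.max 0 (Num.min 1 l).

Lemma clamp_ge0 l : 0 <= clamp l.
Proof. by rewrite /clamp le_max lexx. Qed.

Lemma clamp_le1 l : clamp l <= 1.
Proof. by rewrite /clamp ge_max ler01 ge_min lexx. Qed.

Lemma onem_clamp_ge0 l : 0 <= 1 - clamp l.
Proof. by rewrite subr_ge0 clamp_le1. Qed.

Definition mixture (l : R) (m m' : P) : set (Rd R d) -> \bar R :=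
  measure_add (mscale (NngNum (onem_clamp_ge0 l)) m)
              (mscale (NngNum (clamp_ge0 l)) m').

Section instance.
Variables (l : R) (m m' : P).

HB.instance Definition _ := Measure.on (mixture l m m').

Let mixture_setT : mixture l m m' setT = 1%E.
Proof.
have mscaleT (k : {nonneg R}) (mu : P) : mscale k mu setT = k%:num%:E.
  by rewrite -[RHS]mule1 -(probability_setT mu).
transitivity ((1 - clamp l)%:E + (clamp l)%:E)%E.
  by rewrite /mixture measure_addE; congr (_ + _)%E; exact: mscaleT.
by rewrite -EFinD subrK.
Qed.

HB.instance Definition _ :=
  Measure_isProbability.Build _ _ _ (mixture l m m') mixture_setT.
End instance.

End mixture.

Section definitions.
Context (R : realType) (d : nat).
Local Notation P := (probability (Rd R d) R).

(* \int f d(m' - m) *)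
Definition int_diff (f : Rd R d -> R) (m' m : P) : R :=
  (\int[m']_x f x) - (\int[m]_x f x).

Record flat_derivative (G : P -> R) (dG : P -> Rd R d -> R) : Prop :=
  FlatDerivative {
  flat_measurable : forall m, measurable_fun setT (dG m);
  flat_continuous : forall a, continuous (fun m : weak_prob R d => dG m a);
  flat_bounded : forall m, exists K : R, forall a, `|dG m a| <= K;
  flat_integrable : forall m m' : P,
    lebesgue_measure.-integrable `[0, 1]
      (fun l : R => (int_diff (dG (mixture l m m')) m' m)%:E);
  flat_increment : forall m m' : P,
    G m' - G m =
    \int[lebesgue_measure]_(l in `[0, 1]) int_diff (dG (mixture l m m')) m' m;
  flat_normalized : forall m : P, \int[m]_x dG m x = 0 }.

(* d2F m a' a stands for (delta^2 F / delta m^2)(m, a', a): for each fixed a it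
   is the flat derivative, in the variable a', of m |-> (delta F/delta m)(m, a). *)
Definition second_flat_derivative (dF : P -> Rd R d -> R)
    (d2F : P -> Rd R d -> Rd R d -> R) : Prop :=
  forall a, flat_derivative (dF ^~ a) (fun m a' => d2F m a' a).

Definition flat_convex (F : P -> R) (dF : P -> Rd R d -> R) : Prop :=
  forall m m' : P, F m - F m' <= int_diff (dF m) m m'.

(* An absolutely continuous probability measure together with an everywhere
   defined version of its density. *)
Record acprob := ACProb {
  law :> P;
  density : Rd R d -> R;
  density_measurable : measurable_fun setT density;
  density_ge0 : forall x, 0 <= density x;
  law_density : forall A, measurable A ->
    law A = (\int[lebesgue R d]_(x in A) (density x)%:E)%E }.

Definition lebesgue_density (m : P) (x : Rd R d) : R :=
  fine ('d (charge_of_finite_measure m) '/d (lebesgue R d) x).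

Definition KL (m : P) (pi : acprob) : \bar R :=
  if `[< m `<< pi >] then
    (\int[lebesgue R d]_x
       (ln (lebesgue_density m x / density pi x) * lebesgue_density m x)%:E)%E
  else +oo%E.

Definition gibbs (sigma : R) (U : Rd R d -> R) (pi : acprob) : Prop :=
  exists2 Z : R, 0 < Z &
    forall x, density pi x = Z^-1 * expR (- (2 / sigma ^+ 2) * U x).

Definition energy (sigma : R) (F : P -> R) (pi : acprob) (m : P) : \bar R :=
  ((F m)%:E + (sigma ^+ 2 / 2)%:E * KL m pi)%E.

Definition is_minimizer (V : P -> \bar R) (m : P) : Prop :=
  forall m', (V m <= V m')%E.

Definition rate (sigma : R) (dF : P -> Rd R d -> R) (pi m : acprob)
    (x : Rd R d) : R :=
  dF m x + sigma ^+ 2 / 2 * ln (density m x / density pi x)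
    - sigma ^+ 2 / 2 * fine (KL m pi).

(* The time derivative is taken within [0, +oo[, hence one-sided at t = 0. *)
Record birth_death_solution (sigma : R) (dF : P -> Rd R d -> R)
    (pi m0 : acprob) (m : R -> acprob) : Prop := BirthDeathSolution {
  solution_initial : forall x, density (m 0) x = density m0 x;
  solution_KL : forall t : R, 0 <= t -> (KL (m t) pi < +oo)%E;
  solution_equation : forall (t : R) x, 0 <= t ->
    (s - t)^-1 * (density (m s) x - density (m t) x)
      @[s --> within [set s : R | 0 <= s] t^']
      --> - rate sigma dF pi (m t) x * density (m t) x }.

Definition L2norm_sq (m : acprob) (g : Rd R d -> R) : \bar R :=
  (\int[lebesgue R d]_x (`|g x| ^+ 2 * density m x)%:E)%E.

End definitions.

(* Main.v *)
Require Import Defs.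
From mathcomp Require Import all_boot all_order all_algebra.
From mathcomp Require Import all_classical all_reals all_analysis.
From mathcomp Require Import measurable_realfun ring lra.
Import Order.TTheory GRing.Theory Num.Theory.
Local Open Scope classical_set_scope.
Local Open Scope ring_scope.

Set Implicit Arguments.
Unset Strict Implicit.
Unset Printing Implicit Defensive.

(** Write p, q, w for the densities of m_t, of the minimizer and of pi, put
    s = sigma^2 / 2, and let a be the rate of m_t.  The inequality holds between
    any two measures of finite KL-divergence whose densities have a ratio p / q
    in [rb, Rb] ([energy_gap_le]).

    Convexity of F, and the identity
    p ln(p/w) - q ln(q/w) = (p - q) ln(p/w) - q ln(q/p), bound the energy gap by
    the integral of a (p - q) - s q ln(q/p), up to a multiple of p - q, which
    integrates to 0.  With g = q / p and phi(g) = g ln g - g + 1 >= 0 the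
    integrand becomes, up to another multiple of p - q,
<<
    (a (1 - g) - s phi(g)) p.
>>
    The gain phi(g) comes from the strict convexity of the entropy.  It
    dominates (1 - g)^2 as soon as g is bounded ([entropy_gap_ge]), so that it
    absorbs the cross term by Young's inequality, and only a multiple of a^2 p
    is left, whose integral is the squared L^2(m_t) norm of a.  This Polyak-
    Lojasiewicz inequality therefore already holds under the integral sign
    ([young_density]), without the Cauchy-Schwarz inequality.

    The measure theory makes the integration licit.  The divergence, defined
    through a Radon-Nikodym derivative, is the integral of ln(p/w) p
    ([KL_acprob]).  The negative part of that integrand is at most w, so a
    divergence which is not +oo is a convergent integral ([KL_integrable]).
    Finally the integrals of dF against the two laws are turned into Lebesgue
    integrals ([Rintegral_law]). *)

(** * The pointwise inequality *)

Lemma ln_ge_1BV (R : realType) (x : R) : 0 < x -> 1 - x^-1 <= ln x.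
Proof.
move=> x_gt0; have V_gt0 : 0 < x^-1 by rewrite invr_gt0.
have /le_ln1Dx : -1 < x^-1 - 1 by lra.
have -> : 1 + (x^-1 - 1) = x^-1 by ring.
by rewrite lnV ?posrE//; lra.
Qed.

(** Quadratic lower bound on the relative entropy integrand.  Applying
    ln x >= 1 - 1/x at x = sqrt g gives
    g ln g - g + 1 >= (sqrt g - 1)^2 = (g - 1)^2 / (sqrt g + 1)^2, and
    (sqrt g + 1)^2 <= 2 (g + 1). *)
Lemma entropy_gap_ge (R : realType) (g : R) : 0 < g ->
  (g - 1) ^+ 2 <= 2 * (g + 1) * (g * ln g - g + 1).
Proof.
move=> g_gt0; set x := Num.sqrt g.
have x_gt0 : 0 < x by rewrite sqrtr_gt0.
have gE : g = x ^+ 2 by rewrite sqr_sqrtr// ltW.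
have := ln_ge_1BV x_gt0; rewrite gE lnXn// -[ln x *+ 2]mulr_natr => lnx.
have xln : x - 1 <= x * ln x.
  have -> : x - 1 = x * (1 - x^-1) by rewrite mulrBr mulr1 divff ?gt_eqF.
  by rewrite ler_pM2l.
have gap : (x - 1) ^+ 2 <= x ^+ 2 * (ln x * 2) - x ^+ 2 + 1.
  have : x * (x - 1) <= x * (x * ln x) by rewrite ler_pM2l.
  by rewrite !expr2; lra.
have sq : (x + 1) ^+ 2 <= 2 * (x ^+ 2 + 1).
  by have := sqr_ge0 (x - 1); rewrite !expr2; lra.
have -> : (x ^+ 2 - 1) ^+ 2 = (x + 1) ^+ 2 * (x - 1) ^+ 2 by ring.
by apply: ler_pM; rewrite ?sqr_ge0.
Qed.

(** The theorem before integration: D is the flat derivative at the point, c is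
    s times the divergence, and D + s ln(p/w) - c is the rate.  The term in
    p - q has a constant coefficient, so it disappears after integration.  The
    constant 2 Rb / (s rb) is the Young dual of the coefficient s rb / (4 Rb)
    with which the entropy gap controls (1 - q/p)^2, doubled. *)
Lemma young_density (R : realType) (s rb Rb p q w D c : R) :
  0 < s -> 0 < rb -> 1 < Rb -> 0 < p -> 0 < q -> 0 < w ->
  rb <= p / q <= Rb ->
  D * (p - q) + s * (ln (p / w) * p - ln (q / w) * q) <=
  2 * Rb / (s * rb) * ((D + s * ln (p / w) - c) ^+ 2 * p) +
    (c + s) * (p - q).
Proof.
move=> s_gt0 rb_gt0 Rb_gt1 p_gt0 q_gt0 w_gt0 /andP[le_rb le_Rb].
set a := D + s * ln (p / w) - c.
set g := q / p; have g_gt0 : 0 < g by rewrite divr_gt0.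
set phi := g * ln g - g + 1.
have qE : q = g * p by rewrite /g divfK ?gt_eqF.
have lng : ln (q / w) = ln g + ln (p / w).
  by rewrite /g !ln_div ?posrE//; ring.
have -> : D * (p - q) + s * (ln (p / w) * p - ln (q / w) * q) =
    (a * (1 - g) - s * phi) * p + (c + s) * (p - q).
  by rewrite lng /phi /a qE; ring.
rewrite lerD2r mulrA ler_pM2r//.
have rbV : rb * g <= 1.
  by move: le_rb; rewrite /g ler_pdivlMr// mulrA ler_pdivrMr// mul1r.
have rbRb : rb <= Rb by exact: le_trans le_rb le_Rb.
have phi_ge : rb * (g - 1) ^+ 2 <= 4 * Rb * phi.
  have phi_ge0 : 0 <= phi.
    have := entropy_gap_ge g_gt0; rewrite -/phi => /(le_trans (sqr_ge0 _)).
    by rewrite pmulr_rge0//; lra.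
  (* 2 rb (g + 1) <= 2 (1 + rb) <= 4 Rb, as rb g <= 1, rb <= Rb and 1 < Rb. *)
  apply: (@le_trans _ _ (rb * (2 * (g + 1) * phi))).
    by rewrite ler_pM2l// entropy_gap_ge.
  by rewrite !mulrA ler_wpM2r//; lra.
have Rb_gt0 : 0 < Rb by lra.
suff : rb * (s * (a * (1 - g) - s * phi)) <= 2 * Rb * a ^+ 2.
  move=> le_a2; rewrite [2 * Rb / (s * rb) * _]mulrAC.
  by rewrite ler_pdivlMr ?mulr_gt0//; lra.
(* Clear the denominators and complete the square of 4 Rb a - rb s (1 - g). *)
have sphi : rb * (s ^+ 2 * (g - 1) ^+ 2) * rb <= s ^+ 2 * 4 * Rb * phi * rb.
  rewrite ler_pM2r//; have := ler_wpM2l (sqr_ge0 s) phi_ge; lra.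
have := sqr_ge0 (4 * Rb * a - rb * s * (1 - g)).
have -> : (4 * Rb * a - rb * s * (1 - g)) ^+ 2 =
  8 * Rb * (2 * Rb * a ^+ 2 - rb * (s * a * (1 - g)))
   + rb * (s ^+ 2 * (g - 1) ^+ 2) * rb by ring.
move=> sq.
have Rb8 : 0 < 8 * Rb by rewrite mulr_gt0.
rewrite -subr_ge0 -(pmulr_rge0 _ Rb8).
have e4 : 0 <= 4 * Rb * phi.
  by apply: le_trans phi_ge; rewrite mulr_ge0 ?sqr_ge0// ltW.
have : 0 <= s ^+ 2 * (4 * Rb * phi) * rb.
  by rewrite (mulr_ge0 (mulr_ge0 (sqr_ge0 s) e4))// ltW.
lra.
Qed.

(** * Integrability *)

Lemma measurable_fun_ln_div (R : realType) d (T : measurableType d)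
    (f g : T -> R) : measurable_fun setT f -> measurable_fun setT g ->
  (forall x, 0 < g x) -> measurable_fun setT (fun x => ln (f x / g x)).
Proof.
move=> mf mg g_gt0; apply: measurableT_comp => //.
(* The inverse is measurable as an exponential, 1 / y = exp (- ln y). *)
rewrite (_ : (fun x => f x / g x) = f \* (fun x => expR (- ln (g x)))).
  apply: measurable_funM => //; apply: measurableT_comp => //.
  by apply: measurableT_comp => //; exact: measurableT_comp.
by apply/funext => x /=; rewrite expRN lnK// posrE.
Qed.

(** The integral of f is the difference of those of its positive and negative
    parts.  The latter is finite by domination, so an integral below +oo leaves
    no room for an infinite positive part. *)
Lemma integrable_lower_bound (R : realType) d (T : measurableType d)
    (mu : {measure set T -> \bar R}) (f w : T -> R) :
  measurable_fun setT f -> mu.-integrable setT (EFin \o w) ->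
  (forall x, 0 <= w x) -> (forall x, - w x <= f x) ->
  (\int[mu]_x (f x)%:E < +oo)%E -> mu.-integrable setT (EFin \o f).
Proof.
move=> mf iw w_ge0 wf f_lty.
have mEf : measurable_fun setT (EFin \o f) by exact/measurable_EFinP.
have in_ : mu.-integrable setT ((EFin \o f)^\-)%E.
  apply: le_integrable iw => //; first exact: measurable_funeneg.
  move=> x _; rewrite funenegE /= gee0_abs; last by rewrite le_max lexx orbT.
  rewrite ger0_norm // ge_max !lee_fin w_ge0 andbT.
  by rewrite lerNl.
have ip : mu.-integrable setT ((EFin \o f)^\+)%E.
  apply/integrableP; split; first exact: measurable_funepos.
  under eq_integral do rewrite gee0_abs ?funepos_ge0//.
  move: f_lty; rewrite integralE.
  have nfin := integrable_fin_num measurableT in_.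
  by rewrite lteBlDr// => /lt_le_trans; apply; rewrite leey.
have := integrableB measurableT ip in_.
by apply: eq_integrable => // x _; rewrite [in RHS](funeposneg (EFin \o f)).
Qed.

(** * Measures given by a density *)

Section acprob.
Context (R : realType) (d : nat).
Implicit Types m pi : acprob R d.
Local Notation leb := (lebesgue R d).

Lemma acprob_dominated m : law m `<< leb.
Proof.
apply/null_content_dominatesP => A mA A0; rewrite law_density//.
apply: null_set_integral => //; apply: measurable_funTS.
by apply/measurable_EFinP; exact: density_measurable.
Qed.

Lemma lebesgue_dominated m : (forall x, 0 < density m x) -> leb `<< law m.
Proof.
move=> m_gt0; apply/null_content_dominatesP => A mA mA0.
have mm : measurable_fun A (EFin \o density m).
  by apply/measurable_funTS/measurable_EFinP; exact: density_measurable.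
have /(ae_eq_integral_abs _ mA mm)[N [mN N0 AN]] :
    (\int[leb]_(x in A) `|(EFin \o density m) x| = 0)%E.
  rewrite -[RHS](mA0 : law m A = 0%E) law_density//.
  apply: eq_integral => x _ /=.
  by rewrite ger0_norm ?density_ge0.
apply: (subset_measure0 mA mN _ N0) => x Ax; apply: AN => /= /(_ Ax) [] m0.
by have := m_gt0 x; rewrite m0 ltxx.
Qed.

Lemma integrable_density m : leb.-integrable setT (EFin \o density m).
Proof.
apply/integrableP; split.
  by apply/measurable_EFinP; exact: density_measurable.
under eq_integral => x _ do rewrite gee0_abs ?lee_fin ?density_ge0//.
by rewrite -law_density// probability_setT ltry.
Qed.

Lemma integral_density m : (\int[leb]_x (density m x)%:E = 1)%E.
Proof. by rewrite -law_density// probability_setT. Qed.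

Lemma density_ae_eq m : ae_eq leb setT (EFin \o density m)
  (Radon_Nikodym (charge_of_finite_measure (law m)) leb).
Proof.
have dom := acprob_dominated m.
apply: integral_ae_eq => //.
- exact: integrable_density.
- by move=> A _ mA; rewrite -Radon_Nikodym_integral// -law_density.
Qed.

Lemma Rintegral_law m (f : Rd R d -> R) :
  (law m).-integrable setT (EFin \o f) ->
  \int[law m]_x f x = \int[leb]_x (f x * density m x).
Proof.
move=> intf; have dom := acprob_dominated m.
rewrite /Rintegral -(Radon_Nikodym_change_of_variables dom measurableT intf).
have mf := measurable_int _ intf.
congr fine; apply: ae_eq_integral => //.
- exact: emeasurable_funM.
- apply/measurable_EFinP/measurable_funM; last exact: density_measurable.
  exact/measurable_EFinP.
- exact: ae_eqe_mul2l (ae_eq_sym (density_ae_eq m)).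
Qed.

(** The Radon-Nikodym derivative agrees with the given density only almost
    everywhere, and it may be negative on a null set, where ln takes its default
    value; the two integrands still agree almost everywhere. *)
Lemma KL_acprob m pi : (forall x, 0 < density pi x) ->
  KL m pi = (\int[leb]_x (ln (density m x / density pi x) * density m x)%:E)%E.
Proof.
move=> pi_gt0; have dom := acprob_dominated m.
rewrite /KL asboolT; last first.
  exact: null_dominates_trans dom (lebesgue_dominated pi_gt0).
have mRN : measurable_fun setT (Defs.lebesgue_density m).
  exact: measurableT_comp.
have mk (f : Rd R d -> R) : measurable_fun setT f ->
    measurable_fun setT (fun x => (ln (f x / density pi x) * f x)%:E).
  move=> mf; apply/measurable_EFinP/measurable_funM => //.
  by apply: measurable_fun_ln_div => //; exact: density_measurable.
apply: ae_eq_integral => //; [exact: mk|exact: mk (density_measurable m)|].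
apply: ae_eq_sym.
exact: (ae_eq_comp2
  (fun x y => (ln (fine y / density pi x) * fine y)%:E) (density_ae_eq m)).
Qed.

(** By ln x >= 1 - 1/x the integrand is at least p - w, hence at least - w. *)
Lemma KL_integrable m pi : (forall x, 0 < density pi x) ->
  (KL m pi < +oo)%E ->
  leb.-integrable setT
    (fun x => (ln (density m x / density pi x) * density m x)%:E).
Proof.
move=> pi_gt0; rewrite KL_acprob// => KL_lty.
have mm := density_measurable m; have mpi := density_measurable pi.
apply: (integrable_lower_bound _ (integrable_density pi)) KL_lty.
- by apply: measurable_funM => //; exact: measurable_fun_ln_div.
- exact: density_ge0.
- move=> x; have := density_ge0 m x; rewrite le_eqVlt => /predU1P[<-|m_gt0].
    by rewrite mulr0 oppr_le0 density_ge0.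
  have := ln_ge_1BV (divr_gt0 m_gt0 (pi_gt0 x)).
  move/(ler_wpM2r (ltW m_gt0)); apply: le_trans.
  by rewrite invf_div mulrBl mul1r divfK ?gt_eqF// lerDr ltW.
Qed.

End acprob.

(** * The energy gap *)

(** Division by zero yields 0, so a positive lower bound on a quotient also
    excludes a zero denominator. *)
Lemma ratio_gt0 (R : realType) (p q rb : R) :
  0 < rb -> 0 <= p -> 0 <= q -> rb <= p / q -> 0 < p /\ 0 < q.
Proof.
move=> rb_gt0 p_ge0 q_ge0 /(lt_le_trans rb_gt0) pq_gt0.
split; rewrite lt_def ?p_ge0 ?q_ge0 andbT; apply: contraTneq pq_gt0 => ->.
- by rewrite mul0r ltxx.
- by rewrite invr0 mulr0 ltxx.
Qed.

Section energy.
Context (R : realType) (d : nat).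
Implicit Types (m pi : acprob R d) (F : probability (Rd R d) R -> R).
Local Notation leb := (lebesgue R d).

Lemma energy_lty_KL_lty sigma F pi (m : probability (Rd R d) R) : 0 < sigma ->
  (energy sigma F pi m < +oo)%E -> (KL m pi < +oo)%E.
Proof.
move=> sigma_gt0; rewrite /energy; case: (KL m pi) => [r|//|//].
  by move=> _; rewrite ltry.
by rewrite gt0_muley ?addey// lte_fin divr_gt0// exprn_gt0.
Qed.

(** Integration of [young_density], in which D is dF m x and c is s KL(m | pi).
    Its constant 2 Rb / (s rb) is 4 Rb / (sigma^2 rb), since s = sigma^2 / 2. *)
Lemma energy_gap_le sigma F (dF : probability (Rd R d) R -> Rd R d -> R)
    (C rb Rb : R) pi m m' :
  0 < sigma -> flat_convex F dF ->
  measurable_fun setT (dF m) -> (forall x, `|dF m x| <= C) ->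
  (forall x, 0 < density pi x) ->
  (KL m pi < +oo)%E -> (KL m' pi < +oo)%E ->
  0 < rb -> 1 < Rb -> (forall x, rb <= density m x / density m' x <= Rb) ->
  (energy sigma F pi m - energy sigma F pi m' <=
    (4 * Rb / (sigma ^+ 2 * rb))%:E * L2norm_sq m (rate sigma dF pi m))%E.
Proof.
move=> sigma_gt0 F_convex mdF dF_bound pi_gt0 KL_lty KL'_lty rb_gt0 Rb_gt1.
move=> ratio.
set p := density m; set q := density m'; set w := density pi.
set s := sigma ^+ 2 / 2; set K := 4 * Rb / (sigma ^+ 2 * rb).
have pq_gt0 x : 0 < p x /\ 0 < q x.
  apply: ratio_gt0 rb_gt0 _ _ _; rewrite ?density_ge0//.
  by case/andP: (ratio x).
have s_gt0 : 0 < s by rewrite divr_gt0 ?exprn_gt0.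
have KE : K = 2 * Rb / (s * rb) by rewrite /K /s; field; rewrite !gt_eqF.
have K_gt0 : 0 < K by rewrite divr_gt0 ?mulr_gt0 ?exprn_gt0//; lra.
set a := rate sigma dF pi m.
have ma : measurable_fun setT a.
  apply: measurable_funB; last exact: measurable_cst.
  apply: measurable_funD => //; apply: measurable_funM => //.
  by apply: measurable_fun_ln_div => //; exact: density_measurable.
have ma2 : measurable_fun setT (fun x => `|a x| ^+ 2 * p x).
  apply: measurable_funM; last exact: density_measurable.
  by apply: measurable_funX; exact: measurableT_comp.
have a2_ge0 x : 0 <= `|a x| ^+ 2 * p x.
  by rewrite mulr_ge0 ?exprn_ge0 ?density_ge0.
(* An infinite right-hand side makes the inequality trivial. *)
have [L2oo|L2_lty] := eqVneq (L2norm_sq m a) +oo%E.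
  by rewrite L2oo gt0_muley ?lte_fin// leey.
have ia : leb.-integrable setT (EFin \o (fun x => `|a x| ^+ 2 * p x)).
  apply/integrableP; split; first exact/measurable_EFinP.
  under eq_integral => x _ do rewrite gee0_abs ?lee_fin ?a2_ge0//.
  by rewrite ltey.
have ip := integrable_density m; have iq := integrable_density m'.
have idF (n : acprob R d) :
    leb.-integrable setT (EFin \o (fun x => dF m x * density n x)).
  have iC := integrableZl measurableT C (integrable_density n).
  apply: le_integrable iC => //.
    apply/measurable_EFinP/measurable_funM => //; exact: density_measurable.
  move=> x _ /=; rewrite lee_fin !normrM ler_wpM2r//.
  exact: le_trans (dF_bound x) (ler_norm _).
have ikp := KL_integrable pi_gt0 KL_lty.
have ikq := KL_integrable pi_gt0 KL'_lty.
have KLE := KL_acprob m pi_gt0; have KL'E := KL_acprob m' pi_gt0.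
have dFE (n : acprob R d) :
    \int[law n]_x dF m x = \int[leb]_x (dF m x * density n x).
  apply: Rintegral_law; apply: measurable_bounded_integrable => //.
    by rewrite -ge0_fin_numE// fin_num_measure.
  exists C; split; first exact: num_real.
  by move=> M CM x _ /=; exact: le_trans (dF_bound x) (ltW CM).
have KL_fin : KL m pi \is a fin_num by rewrite KLE integrable_fin_num.
have KL'_fin : KL m' pi \is a fin_num by rewrite KL'E integrable_fin_num.
have L2_fin : L2norm_sq m a \is a fin_num by exact: integrable_fin_num ia.
rewrite /energy -(fineK KL_fin) -(fineK KL'_fin) -(fineK L2_fin) -!EFinM.
rewrite -!EFinD lee_fin.
have := F_convex m m'; rewrite /int_diff !dFE -/s => convex.
set c := s * fine (KL m pi).
set h1 := fun x => dF m x * p x - dF m x * q x.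
set h2 := fun x => ln (p x / w x) * p x - ln (q x / w x) * q x.
have ih1 : leb.-integrable setT (EFin \o h1).
  exact: integrableB (idF m) (idF m').
have ih2 : leb.-integrable setT (EFin \o h2) by exact: integrableB ikp ikq.
have ih2' : leb.-integrable setT (EFin \o (fun x => s * h2 x)).
  exact: (integrableZl measurableT s ih2).
have ipq : leb.-integrable setT (EFin \o (fun x => p x - q x)).
  exact: integrableB ip iq.
have ipq' : leb.-integrable setT (EFin \o (fun x => (c + s) * (p x - q x))).
  exact: (integrableZl measurableT (c + s) ipq).
have ia' : leb.-integrable setT (EFin \o (fun x => K * (`|a x| ^+ 2 * p x))).
  exact: (integrableZl measurableT K ia).
(* By convexity of F the left-hand side below is at least the energy gap. *)
have : \int[leb]_x (h1 x + s * h2 x) <=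
    \int[leb]_x (K * (`|a x| ^+ 2 * p x) + (c + s) * (p x - q x)).
  apply: le_Rintegral => //.
  - exact: integrableD ih1 ih2'.
  - exact: integrableD ia' ipq'.
  move=> x _; rewrite real_normK ?num_real// /h1 -mulrBr.
  have [px qx] := pq_gt0 x.
  rewrite KE.
  exact: young_density s_gt0 rb_gt0 Rb_gt1 px qx (pi_gt0 x) (ratio x).
rewrite (RintegralD measurableT ih1 ih2') (RintegralD measurableT ia' ipq').
rewrite (RintegralZl s measurableT ih2) (RintegralZl (c + s) measurableT ipq).
rewrite (RintegralZl K measurableT ia).
rewrite (RintegralB measurableT (idF m) (idF m')).
rewrite (RintegralB measurableT ikp ikq) (RintegralB measurableT ip iq).
rewrite /Rintegral !integral_density subrr mulr0 addr0 -KLE -KL'E.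
move: convex; rewrite /Rintegral /L2norm_sq -/p -/q /c; lra.
Qed.

End energy.

Theorem theorem2p3 (R : realType) (d : nat) (sigma : R)
  (F : probability (Rd R d) R -> R)
  (dF : probability (Rd R d) R -> Rd R d -> R)
  (d2F : probability (Rd R d) R -> Rd R d -> Rd R d -> R)
  (C C2 : R) (U : Rd R d -> R) (pi m0 : acprob R d) (r R0 : R)
  (mstar : acprob R d) (m : R -> acprob R d) (rbar Rbar : R)
  (sigma_gt0 : 0 < sigma)
  (F_flat : flat_derivative F dF)
  (F_flat2 : second_flat_derivative dF d2F)
  (F_convex : flat_convex F dF)
  (C_gt0 : 0 < C)
  (dF_bound : forall mu x, `|dF mu x| <= C)
  (C2_gt0 : 0 < C2)
  (d2F_bound : forall mu x y, `|d2F mu x y| <= C2)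
  (pi_gibbs : gibbs sigma U pi)
  (r_gt0 : 0 < r) (R0_gt1 : 1 < R0)
  (m0_inf : (r%:E <= ereal_inf (range
     (fun x => (density m0 x / density pi x)%:E)))%E)
  (m0_sup : (ereal_sup (range
     (fun x => (density m0 x / density pi x)%:E)) <= R0%:E)%E)
  (mstar_min : is_minimizer (energy sigma F pi) mstar)
  (m_solution : birth_death_solution sigma dF pi m0 m)
  (rbar_gt0 : 0 < rbar) (Rbar_gt1 : 1 < Rbar)
  (m_bounds : forall (t : R) x, 0 <= t ->
     rbar <= density (m t) x / density mstar x <= Rbar) :
  forall t : R, 0 <= t ->
    (energy sigma F pi (m t) - energy sigma F pi mstar <=
     (4 * Rbar / (sigma ^+ 2 * rbar))%:E
       * L2norm_sq (m t) (rate sigma dF pi (m t)))%E.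
Proof.
move=> t t_ge0.
have pi_gt0 x : 0 < density pi x.
  by have [Z Z_gt0 ->] := pi_gibbs; rewrite mulr_gt0 ?invr_gt0 ?expR_gt0.
have KL_lty := solution_KL m_solution t_ge0.
apply: (@energy_gap_le _ _ _ _ _ C) => //; last by move=> x; exact: m_bounds.
  exact: flat_measurable F_flat (law (m t)).
(* The energy of the minimizer is below the finite energy of m t. *)
apply: (@energy_lty_KL_lty _ _ _ F _ _ sigma_gt0).
apply: le_lt_trans (mstar_min (law (m t))) _.
have KL_fin : KL (m t) pi \is a fin_num.
  by rewrite KL_acprob// integrable_fin_num//; exact: KL_integrable.
by rewrite /energy -(fineK KL_fin) -EFinM -EFinD ltry.
Qed.
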